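(* Let $R$ be a ring such that $R^{\mathbb{N}}$ (the product of countably many copies of $R$) is $(\aleph_0,1)$-flat as a left $R$-module. Then the following conditions are equivalent: (1) $R$ is $\Sigma$-semi-compact as a left $R$-module; (2) each $(\aleph_0,1)$-flat left $R$-module is singly projective.
   Context: Rings are associative with identity and modules are unitary. For a left $R$-module $M$ and a left ideal $I$ of $R$, $M[I]=\{m\in M\mid Im=0\}$. $M$ is semi-compact if every set of congruences $x\equiv x_\alpha\pmod{M[I_\alpha]}$ ($\alpha\in\Lambda$, $x_\alpha\in M$, $I_\alpha$ a left ideal of $R$), each finite subset of which has a common solution in $M$, has a simultaneous solution in $M$. $M$ is $\Sigma$-semi-compact if all direct sums of copies of $M$ are semi-compact. A left $R$-module $M$ is $(m,n)$-flat ($m,n$ positive integers) if for each $n$-generated right submodule $K$ of $R^m$ the homomorphism $K\otimes_R M\to R^m\otimes_R M$ induced by the inclusion is injective; $M$ is $(\aleph_0,1)$-flat if it is $(m,1)$-flat for each integer $m>0$. A left $R$-module $M$ is singly projective if every homomorphism from a cyclic left $R$-module into $M$ factors through a free left $R$-module. *)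

(* Defs.v *)
From HB Require Import structures.
From mathcomp Require Import all_boot all_algebra.
From mathcomp Require Import boolp classical_sets functions cardinality.
From mathcomp Require Import freeg.

Set Implicit Arguments.
Unset Strict Implicit.
Unset Printing Implicit Defensive.

Import GRing.Theory.
Local Open Scope ring_scope.
Local Open Scope quotient_scope.
Local Open Scope classical_set_scope.

(* Left R-modules are [lmodType R]; right R-modules are left modules over the
   converse ring, [lmodType R^c], so that [r *: a] stands for a r. Since every proposition reflects to a boolean (boolp), the boolean
   predicates of [submodClosed V] are exactly the submodules of V; in
   particular [submodClosed R^o] is the type of left ideals of R. *)

Section Submodule.
Context (R : pzRingType) (V : lmodType R).

Record submod (S : submodClosed V) :=
  Submod { submod_val :> V; submod_valP : submod_val \in S }.

HB.instance Definition _ S := [isSub for @submod_val S].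
HB.instance Definition _ S := [Choice of submod S by <:].
HB.instance Definition _ S := [SubChoice_isSubLmodule of submod S by <:].

Definition submod_incl (S : submodClosed V) : {linear submod S -> V} := val.

Definition n_generated (n : nat) (S : submodClosed V) : Prop :=
  exists g : 'I_n -> V,
    forall x, x \in S <-> exists c : 'I_n -> R, x = \sum_i c i *: g i.

End Submodule.

Section DirectSum.
Context (R : pzRingType) (I : Type) (M : lmodType R).

Definition finsupp : {pred I -> M} :=
  fun f => `[< finite_set [set i | f i != 0] >].

Lemma finsupp_submod_closed : submod_closed finsupp.
Proof.
split=> [|a f g /asboolP fF /asboolP fG]; apply/asboolP.
  by apply: (sub_finite_set _ (finite_set0 I)) => i /=; rewrite eqxx.
have fFG : finite_set ([set i | f i != 0] `|` [set i | g i != 0]).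
  by rewrite finite_setU.
apply: sub_finite_set fFG => i /= nz.
have [f0|?] := eqVneq (f i) 0; last by left.
right; apply: contraNneq nz => g0; apply/eqP.
by change (a *: f i + g i = 0); rewrite f0 g0 addr0 scaler0.
Qed.

HB.instance Definition _ :=
  GRing.isSubmodClosed.Build R (I -> M : lmodType R)%type finsupp
    finsupp_submod_closed.

Definition dirsum : lmodType R := submod finsupp.

End DirectSum.

(* A \otimes_R M is the free abelian group on A * M modulo the subgroup
   generated by the usual relators. *)
Section Tensor.
Context (R : pzRingType).

Inductive tensor_relator (A : lmodType R^c) (M : lmodType R) :
    {freeg (A * M) / int} -> Prop :=
| TensorZero : tensor_relator 0
| TensorSub u v :
    tensor_relator u -> tensor_relator v -> tensor_relator (u - v)
| TensorAddL a a' m :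
    tensor_relator (<< (a + a', m) >> - << (a, m) >> - << (a', m) >>)
| TensorAddR a m m' :
    tensor_relator (<< (a, m + m') >> - << (a, m) >> - << (a, m') >>)
| TensorBal a (r : R) m :
    tensor_relator (<< ((r : R^c) *: a, m) >> - << (a, r *: m) >>).

Definition tensor_rel (A : lmodType R^c) (M : lmodType R) :
    {pred {freeg (A * M) / int}} :=
  fun u => `[< tensor_relator u >].

Lemma tensor_rel_zmod_closed (A : lmodType R^c) (M : lmodType R) :
  zmod_closed (@tensor_rel A M).
Proof.
split=> [|u v /asboolP hu /asboolP hv]; apply/asboolP.
  exact: TensorZero.
exact: TensorSub.
Qed.

HB.instance Definition _ (A : lmodType R^c) (M : lmodType R) :=
  GRing.isZmodClosed.Build {freeg (A * M) / int} (@tensor_rel A M)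
    (@tensor_rel_zmod_closed A M).

Definition tensor (A : lmodType R^c) (M : lmodType R) : zmodType :=
  Quotient.quot (@tensor_rel A M).

Definition tensor_pi (A : lmodType R^c) (M : lmodType R)
    (u : {freeg (A * M) / int}) : tensor A M :=
  \pi_(Quotient.quot (@tensor_rel A M)) u.

Definition pure (A : lmodType R^c) (M : lmodType R) (a : A) (m : M) :
  tensor A M := tensor_pi << (a, m) >>.

Definition freeg_map (A B : lmodType R^c) (M : lmodType R) (f : A -> B) :
    {freeg (A * M) / int} -> {freeg (B * M) / int} :=
  fglift (fun p => << (f p.1, p.2) >>).

(* f \otimes M *)
Definition tensor_map (A B : lmodType R^c) (M : lmodType R)
    (f : {linear A -> B}) (t : tensor A M) : tensor B M :=
  tensor_pi (freeg_map f (repr (t : Quotient.quot (@tensor_rel A M)))).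

Lemma freeg_mapU (A B : lmodType R^c) (M : lmodType R) (f : A -> B) a (m : M) :
  freeg_map f << (a, m) >> = << (f a, m) >>.
Proof. by rewrite /freeg_map liftU scale1r. Qed.

Lemma freeg_mapB (A B : lmodType R^c) (M : lmodType R) (f : A -> B)
    (u v : {freeg (A * M) / int}) :
  freeg_map f (u - v) = freeg_map f u - freeg_map f v.
Proof. exact: lift_is_additive. Qed.

Lemma tensor_relator_map (A B : lmodType R^c) (M : lmodType R)
    (f : {linear A -> B}) (u : {freeg (A * M) / int}) :
  tensor_relator u -> tensor_relator (freeg_map f u).
Proof.
elim=> [|{}u v _ hu _ hv|a a' m|a m m'|a r m].
- by rewrite -(subrr 0) freeg_mapB subrr; exact: TensorZero.
- by rewrite freeg_mapB; exact: TensorSub.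
- by rewrite !(freeg_mapB, freeg_mapU) linearD; exact: TensorAddL.
- by rewrite !(freeg_mapB, freeg_mapU); exact: TensorAddR.
- by rewrite !(freeg_mapB, freeg_mapU) linearZ; exact: TensorBal.
Qed.

Lemma tensor_pi_eq (A : lmodType R^c) (M : lmodType R)
    (u v : {freeg (A * M) / int}) :
  tensor_pi u = tensor_pi v <-> tensor_relator (u - v).
Proof.
rewrite -[tensor_relator _]asboolE.
change (tensor_pi u = tensor_pi v <-> u - v \in @tensor_rel A M).
by rewrite Quotient.idealrBE; split=> [/eqP|/eqP].
Qed.

Lemma tensor_map_pi (A B : lmodType R^c) (M : lmodType R)
    (f : {linear A -> B}) (u : {freeg (A * M) / int}) :
  tensor_map f (tensor_pi u) = tensor_pi (freeg_map f u).
Proof.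
apply/tensor_pi_eq; rewrite -freeg_mapB; apply/tensor_relator_map/tensor_pi_eq.
exact: reprK.
Qed.

Lemma tensor_map_pure (A B : lmodType R^c) (M : lmodType R)
    (f : {linear A -> B}) (a : A) (m : M) :
  tensor_map f (pure a m) = pure (f a) m.
Proof. by rewrite /pure tensor_map_pi freeg_mapU. Qed.

Lemma tensor_map_zmod_morphism (A B : lmodType R^c) (M : lmodType R)
    (f : {linear A -> B}) : zmod_morphism (@tensor_map A B M f).
Proof.
have piB (C : lmodType R^c) (u v : {freeg (C * M) / int}) :
    tensor_pi (u - v) = tensor_pi u - tensor_pi v.
  by rewrite /tensor_pi !piE.
have ex (C : lmodType R^c) (t : tensor C M) : exists u, t = tensor_pi u.
  by exists (repr (t : Quotient.quot (@tensor_rel C M))); rewrite /tensor_pi reprK.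
move=> s t; have [u ->] := ex _ s; have [v ->] := ex _ t.
by rewrite -piB !tensor_map_pi freeg_mapB piB.
Qed.

End Tensor.

Section Notions.
Context (R : pzRingType).

(* R^m as a right R-module *)
Definition rpow (m : nat) : lmodType R^c := 'rV[R^c]_m.

Definition mn_flat (m n : nat) (M : lmodType R) : Prop :=
  forall K : submodClosed (rpow m), n_generated n K ->
    injective (@tensor_map R (submod K) (rpow m) M (submod_incl K)).

Definition aleph0_1_flat (M : lmodType R) : Prop :=
  forall m : nat, (0 < m)%N -> mn_flat m 1 M.

(* M[I] *)
Definition annihilated (M : lmodType R) (I : submodClosed R^o) : set M :=
  [set m | forall r : R, r \in I -> r *: m = 0].

Definition semi_compact (M : lmodType R) : Prop :=
  forall (L : Type) (I : L -> submodClosed R^o) (x : L -> M),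
    (forall D : set L, finite_set D ->
       exists y : M, forall a, D a -> annihilated (I a) (y - x a)) ->
    exists y : M, forall a, annihilated (I a) (y - x a).

Definition sigma_semi_compact (M : lmodType R) : Prop :=
  forall I : Type, semi_compact (dirsum I M).

Definition cyclic_module (C : lmodType R) : Prop :=
  exists c : C, forall x : C, exists r : R, x = r *: c.

Definition free_module (F : lmodType R) : Prop :=
  exists (I : Type) (f : {linear F -> dirsum I R^o}), bijective f.

Definition singly_projective (M : lmodType R) : Prop :=
  forall (C : lmodType R) (f : {linear C -> M}), cyclic_module C ->
    exists F : lmodType R, free_module F /\
      exists (g : {linear C -> F}) (h : {linear F -> M}),
        forall x, f x = h (g x).

End Notions.

(* Main.v *)
From HB Require Import structures.
Require Import Defs.
From mathcomp Require Import all_boot all_algebra.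
From mathcomp Require Import boolp classical_sets functions cardinality.
From mathcomp Require Import freeg.

Set Implicit Arguments.
Unset Strict Implicit.
Unset Printing Implicit Defensive.

Import GRing.Theory.
Local Open Scope ring_scope.
Local Open Scope quotient_scope.
Local Open Scope classical_set_scope.

(** Both conditions come down to one on annihilators in R, the second by way of
    the flatness of R^N: every subset A of R contains a finite subset with the
    same right annihilator as A. By dependent choice this fails exactly when
    there are sequences (a_i), (m_n) in R with a_i m_n = 0 for i < n and
    a_n m_n <> 0 for all n ([rann_chain]).

    The two module-theoretic properties are first put in terms of elements.
    For a set P of scalars write P M for the additive subgroup of M generated
    by the products r x with r in P and x in M. Then M is (aleph0, 1)-flat iff
    every x killed by a finite list s lies in (rann s) M, because for v in R^m
    the module (v R) (x) M is M / (rann v) M. And M is singly projective iff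
    every x lies in (rann (ann x)) M, because a map from R x to M through a
    free module is a way to write x as sum_j r_j x_j in which every s with
    s x = 0 satisfies s r_j = 0.

    If the annihilator condition holds, flat implies singly projective at
    once: replace ann x by a finite subset with the same right annihilator.
    A finitely solvable system of congruences in a direct sum of copies of R
    is solved by any common solution of finitely many congruences whose left
    ideals contain a finite subset with the same right annihilator as the
    union of all the left ideals.

    If the annihilator condition fails, let (a_i), (m_n) be a chain as above.
    The truncations of (m_0, m_1, ...) are the finite partial solutions, in the
    direct sum of countably many copies of R, of a system of congruences whose
    solutions in R^N all have infinite support; so R is not Sigma-semi-compact
    ([sigma_semi_compact_finitary_rann]).
    The class of m in the reduced power R^N / R^(N) is killed by every a_i. If
    it were a combination of r_j with a_i r_j = 0 for all i, j, then so would be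
    m_n for large n, against a_n m_n <> 0; so the reduced power is not singly
    projective ([reduced_power_finitary_rann]). The reduced power is
    (aleph0, 1)-flat as soon as R^N is, because a sequence killed by finitely
    many scalars modulo R^(N) is killed by them after its first terms are set
    to 0 ([reduced_power_equational_flat]). *)

(** * Right annihilators of finite sets *)

Section Annihilators.
Context (R : pzRingType).

Definition rann (A : set R) : set R := [set r | forall a, A a -> a * r = 0].

Definition finitary_rann : Prop :=
  forall A : set R, exists s : seq R,
    [set` s] `<=` A /\ rann [set` s] `<=` rann A.

(** A finite subset of A whose right annihilator is too large can always be
    enlarged by an element a of A that does not kill everything in that
    annihilator; m records an element that witnesses this. *)
Lemma rann_chain : ~ finitary_rann ->
  exists a m : nat -> R,
    (forall i n, (i < n)%N -> a i * m n = 0) /\ (forall n, a n * m n <> 0).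
Proof.
move=> /existsNP[A /forallNP noA].
have /choice[F FP] (s : seq R) : exists p : R * R, [set` s] `<=` A ->
    [/\ A p.1, rann [set` s] p.2 & p.1 * p.2 <> 0].
  have [sA|] := pselect ([set` s] `<=` A); last by exists 0.
  have /existsNP[r /not_implyP[sr /existsNP[a /not_implyP[Aa ar]]]] :
    ~ rann [set` s] `<=` rann A by move=> sub; exact: (noA s).
  by exists (a, r).
pose st := fix st n := if n is k.+1 then (F (st k)).1 :: st k else [::].
have stA n : [set` st n] `<=` A.
  elim: n => [|n IHn] a //=; rewrite inE => /predU1P[->|]; last exact: IHn.
  by case: (FP _ IHn).
have st_mem i n : (i < n)%N -> (F (st i)).1 \in st n.
  elim: n => // n IHn; rewrite ltnS leq_eqVlt => /predU1P[->|/IHn] /=.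
    by rewrite inE eqxx.
  by rewrite inE orbC => ->.
exists (fun n => (F (st n)).1), (fun n => (F (st n)).2); split=> [i n ltin|n].
  by have [_ + _] := FP _ (stA n); apply; exact: st_mem.
by case: (FP _ (stA n)).
Qed.

Section Span.
Context (M : lmodType R).

(** The additive subgroup P M of M. *)
Definition coef_span (P : set R) (x : M) : Prop :=
  exists2 s : seq (R * M), (forall p, p \in s -> P p.1)
                         & x = \sum_(p <- s) p.1 *: p.2.

Lemma coef_span0 P : coef_span P 0.
Proof. by exists [::] => //; rewrite big_nil. Qed.

Lemma coef_spanZ P r x : P r -> coef_span P (r *: x).
Proof.
move=> Pr; exists [:: (r, x)]; last by rewrite big_seq1.
by move=> p /[!inE] /eqP->.
Qed.

Lemma coef_spanD P x y : coef_span P x -> coef_span P y -> coef_span P (x + y).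
Proof.
move=> [s sP ->] [t tP ->]; exists (s ++ t); last by rewrite big_cat.
by move=> p /[!mem_cat] /orP[/sP|/tP].
Qed.

Lemma coef_spanB P x y : coef_span P x -> coef_span P y -> coef_span P (x - y).
Proof.
move=> Px [s sP ->]; apply: coef_spanD => //.
exists [seq (p.1, - p.2) | p <- s]; first by move=> _ /mapP[p /sP ? ->].
by rewrite big_map -sumrN; apply: eq_bigr => p _; rewrite scalerN.
Qed.

Lemma sub_coef_span P Q x : P `<=` Q -> coef_span P x -> coef_span Q x.
Proof. by move=> PQ [s sP ->]; exists s => // p /sP /PQ. Qed.

Lemma rann_coef_span A a x : A a -> coef_span (rann A) x -> a *: x = 0.
Proof.
move=> Aa [s sA ->]; rewrite scaler_sumr big_seq big1 // => p /sA pA.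
by rewrite scalerA pA // scale0r.
Qed.

(** For a list s of scalars, every map to M from the finitely presented cyclic
    module R / R s factors through a free module. *)
Definition equational_flat : Prop :=
  forall (s : seq R) (x : M), (forall a, a \in s -> a *: x = 0) ->
    coef_span (rann [set` s]) x.

(** The same for the cyclic module R / ann x, whose relations need not be
    finitely generated. *)
Definition equational_singly_projective : Prop :=
  forall x : M, coef_span (rann [set s | s *: x = 0]) x.

End Span.

Lemma coef_span_linear (M N : lmodType R) (f : {linear M -> N}) P x :
  coef_span P x -> coef_span P (f x).
Proof.
move=> [s sP ->]; exists [seq (p.1, f p.2) | p <- s].
  by move=> _ /mapP[p /sP ? ->].
by rewrite linear_sum big_map; apply: eq_bigr => p _; rewrite linearZ.
Qed.

Lemma coef_span_bij (M N : lmodType R) (f : {linear M -> N}) P x :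
  bijective f -> coef_span P (f x) -> coef_span P x.
Proof.
move=> [g fK gK] [s sP fx]; exists [seq (p.1, g p.2) | p <- s].
  by move=> _ /mapP[p /sP ? ->].
apply: (can_inj fK); rewrite fx linear_sum big_map.
by apply: eq_bigr => p _; rewrite linearZ /= gK.
Qed.

End Annihilators.

(** * Direct sums of copies of the ring *)

Section DirectSums.
Context (R : pzRingType) (I : Type).

Definition delta (i : I) : I -> R^o := fun j => if `[< i = j >] then 1 else 0.

Lemma dirsum_delta_subproof i : delta i \in finsupp (M := R^o).
Proof.
apply/asboolP; apply: sub_finite_set (finite_set1 i) => j /=.
by rewrite /delta; case: asboolP => // _; rewrite eqxx.
Qed.

Definition dirsum_delta i : dirsum I R^o := Submod (dirsum_delta_subproof i).

Lemma coef_span_dirsum (P : set R) (phi : dirsum I R^o) :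
  P 0 -> (forall i, P (submod_val phi i)) -> coef_span P phi.
Proof.
(* Induction on a finite list that contains the support, removing the
   coordinate of its head; the hypothesis [P 0] is for that coordinate. *)
move=> P0 Pphi; have /asboolP/(@finite_seqP {classic I})[s sE] := submod_valP phi.
have {sE} : [set i | submod_val phi i != 0] `<=` [set` s] by rewrite sE.
elim: s phi Pphi => [|i s IHs] phi Pphi sub.
  suff -> : phi = 0 by exact: coef_span0.
  by apply: val_inj; apply/funext => j; apply: contrapT => /eqP /sub.
rewrite -[phi](subrK ((submod_val phi i : R) *: dirsum_delta i)).
have val_sub j : submod_val (phi - (submod_val phi i : R) *: dirsum_delta i) j =
    if `[< i = j >] then 0 else submod_val phi j.
  transitivity (submod_val phi j - submod_val phi i * delta i j) => //.
  rewrite /delta; case: asboolP => [->|_].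
    by rewrite mulr1 subrr.
  by rewrite mulr0 subr0.
apply: coef_spanD; last exact: coef_spanZ.
apply: IHs => [|] j.
  by have -> := val_sub j; case: ifP.
have /= -> := val_sub j; case: asboolP => [|ij /sub /=]; first by rewrite eqxx.
by rewrite inE => /predU1P[ji|//]; case: ij.
Qed.

End DirectSums.

Lemma finsupp_natP (R : pzRingType) (f : nat -> R^o) :
  f \in finsupp (M := R^o) <-> exists n, forall k, (n <= k)%N -> f k = 0.
Proof.
split=> [/asboolP/finite_seqP[s sE]|[n nf]].
  exists (\max_(n <- s) n).+1 => k; apply: contraPP => /eqP fk.
  have : [set i | f i != 0] k by [].
  rewrite sE /= => /(@leq_bigmax_seq _ _ xpredT id) /(_ isT) ?.
  by apply/negP; rewrite -leqNgt.
apply/asboolP; apply: sub_finite_set (finite_II n) => k /=.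
by apply: contraNT; rewrite -leqNgt => /nf ->.
Qed.

(** * Single projectivity in terms of elements *)

Section SinglyProjective.
Context (R : pzRingType).

Definition cyc (V : lmodType R) (v : V) : {pred V} :=
  fun x => `[< exists r, x = r *: v >].

Lemma cyc_submod_closed (V : lmodType R) (v : V) : submod_closed (cyc v).
Proof.
split=> [|a x y /asboolP[r ->] /asboolP[t ->]]; apply/asboolP.
  by exists 0; rewrite scale0r.
by exists (a * r + t); rewrite scalerDl scalerA.
Qed.

HB.instance Definition _ (V : lmodType R) (v : V) :=
  GRing.isSubmodClosed.Build R V (cyc v) (cyc_submod_closed v).

Lemma cyc_gen (V : lmodType R) (v : V) : v \in cyc v.
Proof. by apply/asboolP; exists 1; rewrite scale1r. Qed.

(** Factor the inclusion of R x in M as h \o g through a free module. The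
    coordinates of g x are killed by ann x, and h turns the expansion of g x
    along the basis into the required expression for x. *)
Lemma singly_projective_equational (M : lmodType R) :
  singly_projective M -> equational_singly_projective M.
Proof.
move=> spM x; pose c : submod (cyc x) := Submod (cyc_gen x).
have cycC : cyclic_module (submod (cyc x)).
  exists c => y; have /asboolP[r yE] := submod_valP y.
  by exists r; apply: val_inj; exact: yE.
have [F [[I [f fbij]] [g [h fE]]]] := spM _ (submod_incl (cyc x)) cycC.
have xE : x = h (g c) by rewrite -fE.
rewrite {2}xE.
apply/coef_span_linear/(coef_span_bij fbij)/coef_span_dirsum => [a _|i a ax].
  by rewrite mulr0.
have -> : a * submod_val (f (g c)) i = submod_val (a *: f (g c)) i by [].
suff -> : a *: f (g c) = 0 by [].
have ac : a *: c = 0 by apply: val_inj; exact: ax.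
by rewrite -!linearZ ac !linear0.
Qed.

(** If c generates C and f c = sum_j r_j x_j, then f factors as a c |-> (a r_j)_j
    followed by u |-> sum_j u_j x_j. The first map is well defined because
    a c = 0 gives a (f c) = 0, hence a r_j = 0. *)
Lemma equational_singly_projective_factors (M : lmodType R) :
  equational_singly_projective M -> singly_projective M.
Proof.
move=> spM C f [c cP]; have [s sP fc] := spM (f c).
pose n := size s; pose t := tnth (in_tuple s).
have fin (u : 'I_n -> R^o) : u \in finsupp (M := R^o).
  by apply/asboolP; exact: finite_finset.
have /choice[q qP] := cP.
pose g y : dirsum 'I_n R^o := Submod (fin (fun i => q y * (t i).1)).
pose h (u : dirsum 'I_n R^o) : M := \sum_(i < n) (submod_val u i : R) *: (t i).2.
have gE a y : y = a *: c -> g y = Submod (fin (fun i => a * (t i).1)).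
  move=> yE; apply: val_inj; apply/funext => i /=.
  apply/eqP; rewrite -subr_eq0 -mulrBl; apply/eqP.
  have := sP _ (mem_tnth i (in_tuple s)); apply => /=.
  by rewrite -linearZ scalerBl -qP -yE subrr linear0.
have glin : linear g.
  move=> a y z; rewrite (gE (a * q y + q z)).
    by apply: val_inj; apply/funext => i /=; rewrite mulrDl -mulrA.
  by rewrite scalerDl -scalerA -!qP.
have hlin : linear h.
  move=> a u v; rewrite /h scaler_sumr -big_split; apply: eq_bigr => i _ /=.
  by rewrite scalerA -scalerDl.
pose gL := HB.pack_for {linear C -> dirsum 'I_n R^o} g
  (GRing.isLinear.Build _ _ _ _ _ glin).
pose hL := HB.pack_for {linear dirsum 'I_n R^o -> M} h
  (GRing.isLinear.Build _ _ _ _ _ hlin).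
exists (dirsum 'I_n R^o); split.
  by exists 'I_n, idfun; exists idfun.
exists gL, hL => y; change (f y = h (g y)).
rewrite {1}(qP y) linearZ /= fc scaler_sumr big_tnth.
by apply: eq_bigr => i _; rewrite scalerA.
Qed.

End SinglyProjective.

(** * Flatness in terms of elements *)

Section Flat.
Context (R : pzRingType) (M : lmodType R).

(** A map phi that is balanced and biadditive modulo a subgroup P of M induces
    a map from A (x) M to M / P; stated on the free abelian group, so that
    M / P need not be formed. *)
Lemma fglift_relator (P : set M) (A : lmodType R^c) (phi : A -> M -> M)
    (u : {freeg (A * M) / int}) :
  P 0 -> (forall x y, P x -> P y -> P (x - y)) ->
  (forall a a' x, P (phi (a + a') x - phi a x - phi a' x)) ->
  (forall a x x', P (phi a (x + x') - phi a x - phi a x')) ->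
  (forall a (r : R) x, P (phi ((r : R^c) *: a) x - phi a (r *: x))) ->
  tensor_relator u -> P (fglift (fun p => phi p.1 p.2 : zmodule M) u).
Proof.
move=> P0 PB PDl PDr Pbal.
pose l := fglift (fun p => phi p.1 p.2 : zmodule M).
have lB v w : l (v - w) = l v - l w by exact: lift_is_additive.
have lU a x : l << (a, x) >> = phi a x by rewrite /l liftU scale1r.
rewrite -/l.
elim=> [|v w _ Pv _ Pw|a a' x|a x x'|a r x].
- by rewrite -(subrr 0) lB subrr.
- by rewrite lB; exact: PB.
- by rewrite !(lB, lU); exact: PDl.
- by rewrite !(lB, lU); exact: PDr.
- by rewrite !(lB, lU); exact: Pbal.
Qed.

Lemma tensor_piB (A : lmodType R^c) (u v : {freeg (A * M) / int}) :
  tensor_pi (u - v) = tensor_pi u - tensor_pi v.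
Proof. by rewrite /tensor_pi !piE. Qed.

HB.instance Definition _ (A : lmodType R^c) :=
  GRing.isZmodMorphism.Build {freeg (A * M) / int} (tensor A M)
    (@tensor_pi R A M) (@tensor_piB A).

Lemma tensor_pi_eq0 (A : lmodType R^c) (u : {freeg (A * M) / int}) :
  tensor_pi u = 0 <-> tensor_relator u.
Proof.
rewrite -{2}[u]subr0 -(raddf0 (@tensor_pi R A M)).
exact: tensor_pi_eq.
Qed.

Lemma pureDl (A : lmodType R^c) (a a' : A) (x : M) :
  pure (a + a') x = pure a x + pure a' x.
Proof.
apply/eqP; rewrite -subr_eq0 opprD addrA -!raddfB; apply/eqP/tensor_pi_eq0.
exact: TensorAddL.
Qed.

Lemma pure0l (A : lmodType R^c) (x : M) : pure (0 : A) x = 0.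
Proof. by apply: (addIr (pure 0 x)); rewrite -pureDl !add0r. Qed.

Lemma pureBr (A : lmodType R^c) (a : A) : zmod_morphism (@pure R A M a).
Proof.
move=> x x'; apply/eqP; rewrite eq_sym subr_eq -[x in pure a x](subrK x').
rewrite -subr_eq0 opprD addrA -!raddfB; apply/eqP/tensor_pi_eq0.
exact: TensorAddR.
Qed.

HB.instance Definition _ (A : lmodType R^c) (a : A) :=
  GRing.isZmodMorphism.Build M (tensor A M) (@pure R A M a) (@pureBr A a).

Lemma pure_suml (A : lmodType R^c) (J : Type) (s : seq J) (F : J -> A) (x : M) :
  pure (\sum_(j <- s) F j) x = \sum_(j <- s) pure (F j) x.
Proof.
apply: (big_morph (fun a : A => pure a x)) => [a a'|]; first exact: pureDl.
exact: pure0l.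
Qed.

Lemma pureZ (A : lmodType R^c) (a : A) (r : R) (x : M) :
  pure ((r : R^c) *: a) x = pure a (r *: x).
Proof. by apply/tensor_pi_eq; exact: TensorBal. Qed.

(** Let v be the vector with entries s. If s kills x, then v (x) x is zero in
    R^m (x) M, as one sees by expanding v along the standard basis; so by
    flatness it is already zero in (v R) (x) M. The map v r (x) y |-> r y from
    that module to M / (rann s) M then shows that x lies in (rann s) M. *)
Lemma aleph0_1_flat_equational : aleph0_1_flat M -> equational_flat M.
Proof.
move=> flatM s x sx0.
(* The extra entry 0 makes the rank positive when s is empty. *)
pose m := (size s).+1; pose v : rpow R m := \row_i nth 0 (0 :: s) i.
have vx0 i : (v 0 i : R) *: x = 0.
  rewrite mxE; case: i => -[|i] /= ilt; first by rewrite scale0r.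
  by apply: sx0; exact: mem_nth.
have genv : n_generated 1 (cyc v).
  exists (fun=> v) => w; split=> [/asboolP[r ->]|[c ->]].
    by exists (fun=> r); rewrite big_ord1.
  by apply/asboolP; exists (c ord0); rewrite big_ord1.
pose g : submod (cyc v) := Submod (cyc_gen v).
have pure_v : pure v x = 0 :> tensor (rpow R m) M.
  have -> : v = \sum_(i < m) ((v 0 i : R^c) *: (delta_mx 0 i : rpow R m)).
    exact: row_sum_delta.
  rewrite pure_suml big1 // => i _; rewrite pureZ.
  by rewrite vx0 raddf0.
have pure_g : pure g x = 0 :> tensor (submod (cyc v)) M.
  apply: (flatM m isT _ genv); rewrite tensor_map_pure [LHS]pure_v.
  by rewrite -[in RHS](raddf0 (pure g)) tensor_map_pure raddf0.
(* q is only additive and linear up to the right annihilator of v. *)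
have /choice[q qP] (k : submod (cyc v)) : exists r : R^c, submod_val k = r *: v.
  by have /asboolP := submod_valP k.
have annP (r : R^c) : r *: v = 0 -> rann [set` s] r.
  move=> rv a /= /(nthP 0)[i ilt <-].
  have := congr1 (fun w : rpow R m => w 0 (inord i.+1)) rv.
  by rewrite !mxE /= inordK.
have spanq (r : R) y : (r : R^c) *: v = 0 -> coef_span (rann [set` s]) (r *: y).
  by move=> /annP ?; exact: coef_spanZ.
have : coef_span (rann [set` s])
    (fglift (fun p => (q p.1 : R) *: p.2 : zmodule M)
       (<< (g, x) >> : {freeg _ / int})).
  apply: (@fglift_relator _ _ (fun k y => (q k : R) *: y)).
  - exact: coef_span0.
  - exact: coef_spanB.
  - move=> k k' y; rewrite -!scalerBl; apply: spanq.
    rewrite !scalerBl -!qP.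
    have -> : submod_val (k + k') = submod_val k + submod_val k' by [].
    rewrite -addrA -opprD; exact: subrr.
  - by move=> k y y'; rewrite scalerDr -addrA -opprD subrr; exact: coef_span0.
  - move=> k r y; rewrite scalerA -scalerBl; apply: spanq.
    rewrite scalerBl -qP.
    have -> : submod_val ((r : R^c) *: k) = (r : R^c) *: submod_val k by [].
    by rewrite [in X in X - _]qP scalerA subrr.
  - exact/tensor_pi_eq0.
rewrite liftU scale1r /= => spang.
(* The coefficients q g and 1 of v differ by a right annihilator of v. *)
rewrite -[x](subrK ((q g : R) *: x)); apply: coef_spanD => //.
rewrite -{1}[x]scale1r -scalerBl; apply: spanq.
by rewrite scalerBl scale1r -qP subrr.
Qed.

(** When K is generated by v, every element of K (x) M is v (x) y for a single
    y. Its image in R^m (x) M vanishes only if every entry of v kills y, and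
    then y = sum_j r_j y_j with v r_j = 0 gives
    v (x) y = sum_j (v r_j) (x) y_j = 0. *)
Lemma equational_aleph0_1_flat : equational_flat M -> aleph0_1_flat M.
Proof.
move=> flatM m _ K [gen genP].
set v := gen ord0.
have vK : v \in K by apply/genP; exists (fun=> 1); rewrite big_ord1 scale1r.
pose g : submod K := Submod vK.
have gP (k : submod K) : exists r : R^c, k = r *: g.
  have /genP[c] := submod_valP k; rewrite big_ord1 => kE.
  by exists (c ord0); apply: val_inj; exact: kE.
have pureP (t : tensor (submod K) M) : exists y, t = pure g y.
  have -> : t = tensor_pi (repr (t : Quotient.quot (@tensor_rel R (submod K) M))).
    by rewrite /tensor_pi reprK.
  move: (repr _) => u.
  elim/freeg_ind_dom0: u => [|z [k x] u _ _ [y uE]].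
    by exists 0; rewrite !raddf0.
  have [r kE] := gP k; exists (((r : R) *: (x : M)) *~ (z : int) + y).
  rewrite raddfD /= uE [RHS]raddfD /=; congr (_ + _).
  by rewrite [RHS]raddfMz /= -pureZ -kE /pure -raddfMz freegU_mulz intz.
suff ker0 (t : tensor (submod K) M) : tensor_map (submod_incl K) t = 0 -> t = 0.
  move=> t t' tt'; apply/eqP; rewrite -subr_eq0; apply/eqP/ker0.
  by rewrite tensor_map_zmod_morphism tt' subrr.
have [y ->] := pureP t; rewrite tensor_map_pure => vy0.
have vy i : (v 0 i : R) *: y = 0.
  have rel : tensor_relator (<< (v, y) >> : {freeg (rpow R m * M) / int}).
    exact/tensor_pi_eq0.
  have /= : [set x : M | x = 0]
      (fglift (fun p : rpow R m * M => (p.1 0 i : R) *: p.2 : zmodule M)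
         (<< (v, y) >> : {freeg (rpow R m * M) / int})).
    refine (@fglift_relator [set x : M | x = 0] (rpow R m)
              (fun w y => (w 0 i : R) *: y) _ _ _ _ _ _ rel) => //=.
    - by move=> _ _ -> ->; rewrite subrr.
    - by move=> w w' x; rewrite mxE scalerDl -addrA -opprD subrr.
    - by move=> w x x'; rewrite scalerDr -addrA -opprD subrr.
    - by move=> w r x; rewrite mxE scalerA subrr.
  by rewrite liftU scale1r.
have [|s sP yE] := flatM [seq v 0 i | i : 'I_m] y.
  by move=> a /codomP[i ->].
rewrite yE raddf_sum big_seq big1 // => p /sP ann /=.
rewrite -pureZ; suff -> : (p.1 : R^c) *: g = 0 by rewrite pure0l.
apply: val_inj; apply/rowP => i; rewrite !mxE.
by apply: ann => /=; exact: codom_f.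
Qed.

End Flat.

(** * Quotient modules *)

Section QuotientModule.
Context (R : pzRingType) (V : lmodType R) (S : submodClosed V).

(** A copy of S that carries closure under opposites, which [submodClosed]
    does not record: it follows from scaling by -1. *)
Definition zmod_of_submod : {pred V} := fun x => x \in S.

Lemma zmod_of_submod_closed : zmod_closed zmod_of_submod.
Proof.
split=> [|x y xS yS]; first exact: (rpred0 S).
by apply: (@rpredD _ S) => //; rewrite -scaleN1r; exact: (@rpredZ _ _ S).
Qed.

HB.instance Definition _ :=
  GRing.isZmodClosed.Build V zmod_of_submod zmod_of_submod_closed.

Definition quotmod : Type := Quotient.quot zmod_of_submod.
HB.instance Definition _ := GRing.Zmodule.on quotmod.

Definition quotmod_pi (x : V) : quotmod := \pi_(Quotient.quot zmod_of_submod) x.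

Lemma quotmod_pi_eq x y : quotmod_pi x = quotmod_pi y <-> x - y \in S.
Proof.
change (quotmod_pi x = quotmod_pi y <-> x - y \in zmod_of_submod).
by rewrite Quotient.idealrBE; split=> [/eqP|/eqP].
Qed.

Lemma quotmod_piP (t : quotmod) : exists x, t = quotmod_pi x.
Proof.
by exists (repr (t : Quotient.quot zmod_of_submod)); rewrite /quotmod_pi reprK.
Qed.

Lemma quotmod_piB : zmod_morphism quotmod_pi.
Proof. by move=> x y; rewrite /quotmod_pi !piE. Qed.

HB.instance Definition _ :=
  GRing.isZmodMorphism.Build V quotmod quotmod_pi quotmod_piB.

Definition quotmod_scale (r : R) (t : quotmod) : quotmod :=
  quotmod_pi (r *: repr (t : Quotient.quot zmod_of_submod)).

Lemma quotmod_scale_pi r x : quotmod_scale r (quotmod_pi x) = quotmod_pi (r *: x).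
Proof.
apply/quotmod_pi_eq; rewrite -scalerBr; apply/rpredZ/quotmod_pi_eq.
exact: reprK.
Qed.

Lemma quotmod_scaleA a b t :
  quotmod_scale a (quotmod_scale b t) = quotmod_scale (a * b) t.
Proof. by have [x ->] := quotmod_piP t; rewrite !quotmod_scale_pi scalerA. Qed.

Lemma quotmod_scale1 : left_id 1 quotmod_scale.
Proof.
by move=> t; have [x ->] := quotmod_piP t; rewrite quotmod_scale_pi scale1r.
Qed.

Lemma quotmod_scaleDr : right_distributive quotmod_scale +%R.
Proof.
move=> a t u; have [[x ->] [y ->]] := (quotmod_piP t, quotmod_piP u).
by rewrite -raddfD !quotmod_scale_pi scalerDr raddfD.
Qed.

Lemma quotmod_scaleDl t : {morph quotmod_scale^~ t : a b / a + b}.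
Proof.
move=> a b; have [x ->] := quotmod_piP t.
by rewrite !quotmod_scale_pi scalerDl raddfD.
Qed.

HB.instance Definition _ := GRing.Zmodule_isLmodule.Build R quotmod
  quotmod_scaleA quotmod_scale1 quotmod_scaleDr quotmod_scaleDl.

Lemma quotmod_pi_scalable : scalable quotmod_pi.
Proof. by move=> r x; rewrite -quotmod_scale_pi. Qed.

HB.instance Definition _ :=
  GRing.isScalable.Build R V quotmod *:%R quotmod_pi quotmod_pi_scalable.

Lemma quotmod_pi_eq0 x : quotmod_pi x = 0 <-> x \in S.
Proof. by rewrite -(raddf0 quotmod_pi) quotmod_pi_eq subr0. Qed.

Lemma coef_span_quotmod P (x : V) : coef_span P (quotmod_pi x) ->
  exists2 y, coef_span P y & x - y \in S.
Proof.
pose rep (t : quotmod) : V := repr (t : Quotient.quot zmod_of_submod).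
move=> [s sP xE]; exists (\sum_(p <- s) p.1 *: rep p.2).
  exists [seq (p.1, rep p.2) | p <- s]; last by rewrite big_map.
  by move=> _ /mapP[p /sP ? ->].
apply/quotmod_pi_eq; rewrite xE linear_sum; apply: eq_bigr => p _.
by rewrite linearZ /= /quotmod_pi reprK.
Qed.

End QuotientModule.

(** * Semi-compactness of direct sums *)

Section SemiCompact.
Context (R : pzRingType).

Definition lann (M : lmodType R) (A : set M) : {pred R^o} :=
  fun r => `[< forall x, A x -> (r : R) *: x = 0 >].

Lemma lann_submod_closed (M : lmodType R) (A : set M) : submod_closed (lann A).
Proof.
split=> [|a r t /asboolP rA /asboolP tA]; apply/asboolP => x Ax.
  by rewrite scale0r.
change ((a * (r : R) + t) *: x = 0).
by rewrite scalerDl -scalerA rA // tA // scaler0 addr0.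
Qed.

HB.instance Definition _ (M : lmodType R) (A : set M) :=
  GRing.isSubmodClosed.Build R R^o (lann A) (lann_submod_closed A).

Lemma submod_val_scale (I : Type) (r : R) (u : dirsum I R^o) i :
  submod_val (r *: u) i = r * submod_val u i.
Proof. by []. Qed.

Lemma submod_valB (I : Type) (u v : dirsum I R^o) i :
  submod_val (u - v) i = submod_val u i - submod_val v i.
Proof. by []. Qed.

(** Two solutions of finitely many congruences whose left ideals contain s
    differ by an element killed by s, hence by every left ideal of the system;
    so a solution of those congruences solves all the others as well. *)
Lemma finitary_rann_semi_compact : finitary_rann R -> sigma_semi_compact R^o.
Proof.
move=> fin I L J x solv.
have [s [sJ rsJ]] := fin [set r | exists a, (r : R^o) \in J a].
have [D [Dfin Ds]] : exists D : set L,
    finite_set D /\ forall r, r \in s -> exists2 a, D a & (r : R^o) \in J a.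
  elim: s sJ {rsJ} => [|r s IHs] sJ; first by exists set0; split.
  have [|D [Dfin Ds]] := IHs.
    by move=> t ts; apply: sJ; rewrite /= inE ts orbT.
  have [|a ra] := sJ r; first by rewrite /= inE eqxx.
  exists (a |` D); split; first by rewrite finite_setU.
  move=> t; rewrite inE => /predU1P[->|/Ds[b Db tb]]; first by exists a => //; left.
  by exists b => //; right.
have [y yD] := solv D Dfin; exists y => a.
have [|z zD] := solv (a |` D); first by rewrite finite_setU.
have yz i : rann [set` s] (submod_val (y - z) i).
  move=> r /= /Ds[b Db rb]; change (submod_val (r *: (y - z)) i = 0).
  suff -> : r *: (y - z) = 0 by [].
  rewrite -[y](subrK (x b)) -addrA scalerDr yD // add0r -opprB scalerN.
  by rewrite zD ?oppr0 //; right.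
move=> r ra; rewrite -[y](subrK z) -addrA scalerDr [X in _ + X]zD ?addr0 //; last first.
  by left.
apply: val_inj; apply/funext => i; apply: (rsJ _ (yz i)).
by exists a.
Qed.

Lemma trunc_finsupp (m : nat -> R^o) n :
  (fun k => if (k < n)%N then m k else 0) \in finsupp (M := R^o).
Proof. by apply/finsupp_natP; exists n => k nk; rewrite ltnNge nk. Qed.

(** For k >= n, the truncations x_k and x_n of a chain m are congruent modulo
    the left annihilator J_n of the tail (m_k)_(k >= n). A common solution y has
    y_k = 0 for some k, and the congruence modulo J_(k+1), which contains a_k,
    then gives a_k m_k = 0. *)
Lemma sigma_semi_compact_finitary_rann :
  sigma_semi_compact (R^o : lmodType R) -> finitary_rann R.
Proof.
move=> sc; apply: contrapT => /rann_chain[a [m [am0 am_neq0]]].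
pose x n : dirsum nat R^o := Submod (trunc_finsupp m n).
pose J n := lann [set (m k : R^o) | k in [set k | (n <= k)%N]] : submodClosed R^o.
have Ja i n : (i < n)%N -> (a i : R^o) \in J n.
  move=> ltin; apply/asboolP => _ [k nk <-]; apply: am0.
  exact: leq_trans ltin nk.
have [|y yP] := sc nat nat J x.
  move=> D /finite_seqP[s ->]; exists (x (\max_(n <- s) n)) => n /= ns r.
  move=> /asboolP rJ; apply: val_inj; apply/funext => k.
  change (r * ((if (k < \max_(n <- s) n)%N then m k else 0)
               - (if (k < n)%N then m k else 0)) = 0).
  have nmax : (n <= \max_(n <- s) n)%N by exact: leq_bigmax_seq.
  case: ltnP => [_|maxk]; last by rewrite ltnNge (leq_trans nmax maxk) subr0 mulr0.
  case: ltnP => [_|nk]; first by rewrite subrr mulr0.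
  by rewrite subr0; apply: rJ; exists k.
have /finsupp_natP[k /(_ k (leqnn k)) yk] := submod_valP y.
apply: (am_neq0 k).
have /(congr1 (fun u : dirsum nat R^o => submod_val u k)) :=
  yP k.+1 _ (Ja k k.+1 (ltnSn k)).
rewrite submod_val_scale submod_valB yk /= ltnSn sub0r mulrN => /eqP.
by rewrite oppr_eq0 => /eqP.
Qed.

End SemiCompact.

(** * Flat modules and the reduced power of the ring *)

Section ReducedPower.
Context (R : pzRingType).

Lemma finitary_rann_singly_projective (M : lmodType R) :
  finitary_rann R -> equational_flat M -> equational_singly_projective M.
Proof.
move=> fin flatM x; have [s [sx rs]] := fin [set s | s *: x = 0].
by apply: sub_coef_span rs _; apply: flatM => a /sx.
Qed.

(** R^N / R^(N). *)
Definition reduced_power : lmodType R :=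
  quotmod (@finsupp R nat R^o : submodClosed (nat -> R^o : lmodType R)%type).

(** Scalars that kill the class of a sequence x kill its terms x_k for large k.
    Setting the other terms to 0 does not change the class and gives a sequence
    to which the flatness of R^N applies. *)
Lemma reduced_power_equational_flat :
  equational_flat (nat -> R^o : lmodType R)%type -> equational_flat reduced_power.
Proof.
move=> flatN s t sx0; have [x xE] := quotmod_piP t; rewrite {t}xE in sx0 *.
have [n xn] : exists n, forall k, (n <= k)%N -> forall a, a \in s -> a * x k = 0.
  elim: s sx0 => [|a s IHs] sx0; first by exists 0%N.
  have [|n xn] := IHs; first by move=> b bs; apply: sx0; rewrite inE bs orbT.
  have /finsupp_natP[p xp] : a *: x \in finsupp (M := R^o).
    by apply/quotmod_pi_eq0; rewrite linearZ; apply: sx0; rewrite inE eqxx.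
  exists (maxn n p) => k; rewrite geq_max => /andP[nk pk] b.
  by rewrite inE => /predU1P[->|]; [exact: xp|exact: xn].
pose z : nat -> R^o := fun k => if (k < n)%N then 0 else x k.
have -> : quotmod_pi (@finsupp R nat R^o) x = quotmod_pi _ z.
  apply/quotmod_pi_eq/finsupp_natP; exists n => k nk.
  change (x k - (if (k < n)%N then 0 else x k) = 0).
  by rewrite ltnNge nk subrr.
apply/coef_span_linear/flatN => a sa; apply/funext => k.
change (a * (if (k < n)%N then 0 else x k) = 0).
by case: ltnP => [_|nk]; rewrite ?mulr0 ?xn.
Qed.

(** The class of a chain m in the reduced power is killed by every a_i, so m
    agrees from some n on with a combination y of scalars killed on the left by
    all the a_i, and a_n m_n = a_n y_n = 0. *)
Lemma reduced_power_finitary_rann :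
  equational_singly_projective reduced_power -> finitary_rann R.
Proof.
move=> sp; apply: contrapT => /rann_chain[a [m [am0 am_neq0]]].
have /coef_span_quotmod[y yspan] :=
  sp (quotmod_pi (@finsupp R nat R^o) (m : nat -> R^o)).
move=> /finsupp_natP[n /(_ n (leqnn n)) /= /subr0_eq myn].
apply: (am_neq0 n).
have ay : a n *: y = 0.
  apply: rann_coef_span yspan => /=; rewrite -linearZ.
  by apply/quotmod_pi_eq0/finsupp_natP; exists n.+1 => k; exact: am0.
by rewrite myn; exact: (congr1 (fun f : nat -> R^o => f n) ay).
Qed.

End ReducedPower.

Theorem corollary3p1 (R : pzRingType)
    (hflat : @aleph0_1_flat R (nat -> R^o)%type) :
  @sigma_semi_compact R R^o <->
  (forall M : lmodType R, @aleph0_1_flat R M -> @singly_projective R M).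
Proof.
split=> [/sigma_semi_compact_finitary_rann fin M /aleph0_1_flat_equational flatM|sp].
  exact/equational_singly_projective_factors/finitary_rann_singly_projective.
apply/finitary_rann_semi_compact/reduced_power_finitary_rann.
apply/singly_projective_equational/sp/equational_aleph0_1_flat.
apply/reduced_power_equational_flat.
exact: aleph0_1_flat_equational.
Qed.
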